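(* Let $(X,X^+)$ be an ordered Banach space whose cone $X^+$ is normal and has non-empty interior, and let $T\in\mathcal{L}(X)$ be positive. Then the following assertions are equivalent: (i) $\operatorname{r}(T) < 1$. (ii) (Dual small-gain condition) For each $0 \neq x' \in (X')^+$ we have $T'x' \not\ge x'$. (iii) For every interior point $z$ of $X^+$ there is $\eta>0$ such that $Tx \not\ge x - \eta\|x\| z$ for all $x \in X^+\setminus\{0\}$. (iv) There exist an interior point $z$ of $X^+$ and $\eta>0$ such that $Tx \not\ge x - \eta\|x\| z$ for all $x \in X^+\setminus\{0\}$. (v) There exists an interior point $z$ of $X^+$ such that $Tz \ll z$. (vi) There exist an interior point $z$ of $X^+$ and $\lambda\in(0,1)$ such that $Tz \le \lambda z$. (vii) (Strong stability) $T^k x \to 0$ as $k\to\infty$ for each $x\in X$. (viii) For each $x \in X^+$ we have $\inf_{k\ge 0}\|T^k x\| = 0$.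
   Context: An ordered Banach space $(X,X^+)$ is a real Banach space $X$ with a non-empty closed set $X^+$ such that $\alpha X^+ + \beta X^+\subseteq X^+$ for $\alpha,\beta\ge0$ and $X^+\cap(-X^+)=\{0\}$; $x\le y$ means $y-x\in X^+$, and $x\not\ge y$ means $x-y\notin X^+$. The cone is normal if there is $C>0$ with $\|x\|\le C\|y\|$ whenever $0\le x\le y$. $x\ll y$ means $y-x$ lies in the topological interior of $X^+$. $T$ is positive if $TX^+\subseteq X^+$; $T'$ denotes the dual (adjoint) operator on the dual space $X'$, and $(X')^+=\{x'\in X':x'(x)\ge0 \ \forall x\in X^+\}$ with the induced order. $\operatorname{r}(T)$ is the spectral radius of (the complexification of) $T$. *)

(* Defs.v *)
From HB Require Import structures.
From mathcomp Require Import all_boot all_order all_algebra.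
From mathcomp Require Import all_classical all_reals all_analysis.
Set Implicit Arguments. Unset Strict Implicit. Unset Printing Implicit Defensive.
Import Order.TTheory GRing.Theory Num.Theory.
Import numFieldNormedType.Exports.
Local Open Scope classical_set_scope.
Local Open Scope ring_scope.

Section OrderedBanach.
Variables (R : realType) (X : normedModType R).

Definition is_cone (C : set X) : Prop :=
  [/\ C !=set0, closed C,
      (forall (a b : R) (x y : X), 0 <= a -> 0 <= b -> C x -> C y -> C (a *: x + b *: y))
    & (forall x : X, C x -> C (- x) -> x = 0)].

Definition cone_le (C : set X) (x y : X) : Prop := C (y - x).

Definition cone_ll (C : set X) (x y : X) : Prop := (C°) (y - x).

Definition normal_cone (C : set X) : Prop :=
  exists c : R, 0 < c /\
    forall x y : X, cone_le C 0 x -> cone_le C x y -> `|x| <= c * `|y|.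

Definition positive_op (C : set X) (T : X -> X) : Prop := T @` C `<=` C.

Definition dual_elt (f : X -> R) : Prop := linear f /\ continuous f.

Definition dual_pos (C : set X) (f : X -> R) : Prop := forall x, C x -> 0 <= f x.

Definition dual_op (T : X -> X) (f : X -> R) : X -> R := fun x => f (T x).

(* Complexification X_C = X * X (pairs x + i y); the operator
   T_C - (a + i b) acts as (x, y) |-> (T x - a x + b y, T y - b x - a y). *)
Definition complexified_shift (T : X -> X) (a b : R) : X * X -> X * X :=
  fun p => (T p.1 - a *: p.1 + b *: p.2, T p.2 - b *: p.1 - a *: p.2).

(* a + i b is in the spectrum of T_C iff T_C - (a+ib) is not invertible in
   L(X_C), i.e. has no continuous two-sided inverse. *)
Definition spectrum (T : X -> X) : set (R * R) :=
  [set ab | ~ exists S : X * X -> X * X,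
      [/\ continuous S, cancel (complexified_shift T ab.1 ab.2) S
        & cancel S (complexified_shift T ab.1 ab.2)]].

(* spectral radius, as an extended real (= -oo when the spectrum is empty,
   which only happens for X = {0}) *)
Definition spectral_radius (T : X -> X) : \bar R :=
  ereal_sup [set (Num.sqrt (ab.1 ^+ 2 + ab.2 ^+ 2))%:E | ab in spectrum T].

End OrderedBanach.

(* Main.v *)
(** An interior point [z] of the cone is an order unit, so by normality
    [T z <= l z] with [l < 1] gives [`|T^n x| <= K l^n `|x|]; this yields
    [r(T) <= l] by the Neumann series on the complexification, strong
    stability, and both small-gain conditions.  Conversely such a [z] is
    obtained:
    - from (viii) as [z = \sum_(j < k) q^-j T^j u], where [T^k u <= u / 2] and
      [q < 1] satisfies [q^k >= 1 / 2];
    - from (ii) by separating the interior of the cone from [(I - T) C];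
    - from (i) and (iv) by continuation in a real parameter.  For large [l]
      some interior [y] satisfies [T y << l y].  Both assumptions bound the
      positive solutions [x] of [l x - T x ~ u] uniformly as [l] decreases to
      any [l0 >= 1], so the set of such [l] reaches [1].
    Only real resolvents occur in the continuation, so no complex analysis is
    needed to exploit (i). *)
Require Import Defs.
From HB Require Import structures.
From mathcomp Require Import all_boot all_order all_algebra.
From mathcomp Require Import all_classical all_reals all_analysis.
From mathcomp Require Import ring lra.
Import Order.TTheory GRing.Theory Num.Theory.
Import numFieldNormedType.Exports.
Local Open Scope classical_set_scope.
Local Open Scope ring_scope.

(** * Linear identities in modules, decided by comparing coefficients *)

Section ModuleIdentities.
Variables (R : pzRingType) (V : lmodType R).

Inductive mexpr :=
  | MVar of nat
  | MZero
  | MAdd of mexpr & mexpr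
  | MOpp of mexpr
  | MScale of R & mexpr.

Fixpoint meval (env : seq V) (e : mexpr) : V :=
  match e with
  | MVar n => nth 0 env n
  | MZero => 0
  | MAdd e1 e2 => meval env e1 + meval env e2
  | MOpp e1 => - meval env e1
  | MScale a e1 => a *: meval env e1
  end.

Fixpoint mcoef (e : mexpr) (i : nat) : R :=
  match e with
  | MVar n => if Nat.eqb n i then 1 else 0
  | MZero => 0
  | MAdd e1 e2 => mcoef e1 i + mcoef e2 i
  | MOpp e1 => - mcoef e1 i
  | MScale a e1 => a * mcoef e1 i
  end.

Fixpoint mbounded (e : mexpr) (n : nat) : bool :=
  match e with
  | MVar k => (k < n)%N
  | MZero => true
  | MAdd e1 e2 => mbounded e1 n && mbounded e2 n
  | MOpp e1 => mbounded e1 n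
  | MScale a e1 => mbounded e1 n
  end.

(** A recursion rather than a quantifier over indices, so that it computes to one scalar equation
    per atom. *)
Fixpoint magree (n : nat) (e1 e2 : mexpr) : Prop :=
  match n with
  | 0%N => True
  | S n' => mcoef e1 n' = mcoef e2 n' /\ magree n' e1 e2
  end.

Lemma meval_sum (env : seq V) e : mbounded e (size env) ->
  meval env e = \sum_(i < size env) mcoef e i *: nth 0 env i.
Proof.
elim: e => [n|_|e1 IH1 e2 IH2 /andP[/IH1 h1 /IH2 h2]|e IH /IH h|a e IH /IH h] /=.
- move=> nl; rewrite (bigD1 (Ordinal nl))//= PeanoNat.Nat.eqb_refl scale1r.
  rewrite big1 ?addr0// => i ine.
  case: (PeanoNat.Nat.eqb_spec n i) => [ni|_]; last by rewrite scale0r.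
  by case/eqP: ine; apply: val_inj.
- by rewrite big1// => i _; rewrite scale0r.
- by rewrite h1 h2 -big_split; apply: eq_bigr => i _; rewrite scalerDl.
- by rewrite h -sumrN; apply: eq_bigr => i _; rewrite scaleNr.
- by rewrite h scaler_sumr; apply: eq_bigr => i _; rewrite scalerA.
Qed.

Lemma meval_eq (env : seq V) e1 e2 :
  mbounded e1 (size env) && mbounded e2 (size env) ->
  magree (size env) e1 e2 -> meval env e1 = meval env e2.
Proof.
move=> /andP[b1 b2] H; rewrite !meval_sum//.
apply: eq_bigr => i _; congr (_ *: _).
move: (nat_of_ord i) (ltn_ord i) => k.
elim: (size env) H => [//|n IH] /= [h1 h2]; rewrite ltnS leq_eqVlt.
by move=> /predU1P[->//|]; exact: IH.
Qed.

End ModuleIdentities.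

(* Atoms are compared up to conversion, as the same vector may occur with
   different canonical structures. *)
Ltac module_index x env :=
  lazymatch env with
  | cons ?y ?env' =>
    match O with
    | _ => let same := constr:(erefl x : x = y) in constr:(O)
    | _ => let n := module_index x env' in constr:(S n)
    end
  end.

Ltac module_atoms env t :=
  lazymatch t with
  | 0 => env
  | ?a + ?b => let env' := module_atoms env a in module_atoms env' b
  | - ?a => module_atoms env a
  | _ *: ?a => module_atoms env a
  | _ => match env with
         | _ => let n := module_index t env in env
         | _ => constr:(cons t env)
         end
  end.

Ltac module_reify R env t :=
  lazymatch t with
  | 0 => constr:(@MZero R)
  | ?a + ?b => let x := module_reify R env a in
               let y := module_reify R env b in constr:(@MAdd R x y)
  | - ?a => let x := module_reify R env a in constr:(@MOpp R x)
  | ?c *: ?a => let x := module_reify R env a in constr:(@MScale R c x)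
  | _ => let n := module_index t env in constr:(@MVar R n)
  end.

(* Proves an equality between linear combinations of vectors by comparing
   coefficients; the scalar equations go to [ring] or [field]. *)
Ltac module_with R V :=
  lazymatch goal with
  | |- ?l = ?r =>
    let env := module_atoms (@nil V) l in
    let env := module_atoms env r in
    let e1 := module_reify R env l in
    let e2 := module_reify R env r in
    apply: (@meval_eq R V env e1 e2);
    [ exact: isT
    | cbn [magree mcoef size Nat.eqb]; repeat split;
      try by [ring | field; do ?[apply/andP; split]] ]
  end.

(** * Maximal convex cones and positive functionals *)

Section Separation.
Variables (R : realType) (V : lmodType R).
Implicit Types (K : set V) (u x y : V).

Ltac module := module_with R V.

Definition convex_cone K : Prop :=
  [/\ K 0, (forall x y, K x -> K y -> K (x + y))
    & (forall (a : R) x, 0 <= a -> K x -> K (a *: x))].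

(** Zorn's lemma yields a maximal convex cone [M] that contains [K] and omits [- u]. If it contained
    neither [x] nor [- x], adjoining either one would produce [- u]; a positive combination of the
    two resulting relations cancels [x] and puts [- u] in [M]. *)
Lemma total_convex_cone_extension K u : convex_cone K -> ~ K (- u) ->
  exists M, [/\ convex_cone M, K `<=` M, ~ M (- u) & forall x, M x \/ M (- x)].
Proof.
move=> cK Ku.
pose P A := A = set0 \/ [/\ convex_cone A, K `<=` A & ~ A (- u)].
have [F FP Ftot|M [PM maxM]] := @Zorn_bigcup V P.
  have [[A0 [FA0 A00]]|F0] := pselect (exists A, F A /\ A != set0); last first.
    left; apply/seteqP; split => // x [A FA Ax].
    by case: F0; exists A; split => //; apply/set0P; exists x.
  have good A x : F A -> A x -> [/\ convex_cone A, K `<=` A & ~ A (- u)].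
    by move=> FA Ax; case: (FP _ FA) => // AE; move: Ax; rewrite AE.
  have /set0P[x0 A0x0] := A00.
  have [[A0_0 _ _] KA0 _] := good _ _ FA0 A0x0.
  right; split.
  - split; first by exists A0.
    + move=> x y [A FA Ax] [B FB By].
      have [[_ AD _] _ _] := good _ _ FA Ax.
      have [[_ BD _] _ _] := good _ _ FB By.
      by case: (Ftot _ _ FA FB) => AB; [exists B|exists A] => //;
        [apply: BD => //; apply: AB|apply: AD => //; apply: AB].
    + move=> a x a0 [A FA Ax]; have [[_ _ AZ] _ _] := good _ _ FA Ax.
      by exists A => //; apply: AZ.
  - by move=> x /KA0 A0x; exists A0.
  - by move=> [A FA Au]; have [_ _] := good _ _ FA Au.
have [cM KM Mu] : [/\ convex_cone M, K `<=` M & ~ M (- u)].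
  case: PM => // M0; exfalso; apply: (maxM K); last by right; split.
  rewrite M0; split => //; move=> /(_ 0); apply.
  by case: cK.
exists M; split => // x.
have [M0 MD MZ] := cM.
(* The cone [B] generated by [M] and [y] is larger than [M], so it contains [- u]; the coefficient
   [t] is nonzero because [M] omits [- u]. *)
have step y : ~ M y -> exists2 t : R, 0 < t & M (- u - t *: y).
  move=> My; pose B : set V := [set v | exists2 t : R, 0 <= t & M (v - t *: y)].
  have MB : M `<=` B by move=> v Mv; exists 0 => //; rewrite scale0r subr0.
  apply: contrapT => nt; apply: (maxM B).
    split=> // BM; apply: My; apply: BM; exists 1; first exact: ler01.
    by rewrite scale1r subrr.
  right; split.
  - split; first exact: MB.
    + move=> v w [s s0 Mv] [t t0 Mw]; exists (s + t); first exact: addr_ge0.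
      suff -> : v + w - (s + t) *: y = (v - s *: y) + (w - t *: y) by exact: MD.
      module.
    + move=> a v a0 [s s0 Mv]; exists (a * s); first exact: mulr_ge0.
      suff -> : a *: v - (a * s) *: y = a *: (v - s *: y) by exact: MZ.
      module.
  - exact: subset_trans KM MB.
  - move=> [t]; rewrite le_eqVlt => /predU1P[<-|t0]; last by move=> ?; apply: nt; exists t.
    by rewrite scale0r subr0.
apply: contrapT => /not_orP[/step[s s0 Ms] /step[t t0 Mt]].
have st0 : 0 < s + t by exact: addr_gt0.
apply: Mu.
suff -> : - u = (s + t)^-1 *: (t *: (- u - s *: x) + s *: (- u - t *: - x)).
  by apply: (MZ _ _); [rewrite invr_ge0 ltW|apply: MD; apply: (MZ _ _) => //; exact: ltW].
have stn0 : s + t != 0 by rewrite gt_eqF.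
module.
Qed.

(* With [M] the maximal cone above, [f x] is the only [r] such that [x]
   lies between [(r - e) *: u] and [(r + e) *: u] for the order of [M],
   for all [e > 0]. *)
Lemma positive_functional K u : convex_cone K -> ~ K (- u) ->
    (forall x, exists t : R, K (t *: u - x)) ->
  exists f : V -> R, [/\ forall a x y, f (a *: x + y) = a * f x + f y,
    forall x, K x -> 0 <= f x & f u = 1].
Proof.
move=> cK Ku uK.
have [M [[M0 MD MZ] KM Mu Mtot]] := total_convex_cone_extension K u cK Ku.
have Mu_ge0 (r : R) : M (r *: u) -> 0 <= r.
  move=> Mr; rewrite leNgt; apply/negP => r0; apply: Mu.
  have -> : - u = (- r)^-1 *: (r *: u) by have rn0 : r != 0 := ltr0_neq0 r0; module.
  by apply: (MZ _ _) => //; rewrite invr_ge0 oppr_ge0 ltW.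
have Ku1 : M u.
  have [//|//] := Mtot u.
pose B x (r : R) := forall e : R, 0 < e -> M (x - (r - e) *: u) /\ M ((r + e) *: u - x).
have B_le x r s : B x r -> B x s -> r <= s.
  move=> Br Bs; apply/ler_addgt0Pr => e e0.
  have e2 : 0 < e / 2 by lra.
  have [h _] := Br _ e2; have [_ h'] := Bs _ e2.
  have := MD _ _ h h'.
  have -> : x - (r - e / 2) *: u + ((s + e / 2) *: u - x) = (s + e - r) *: u by module.
  by move=> /Mu_ge0; lra.
have B_uniq x r s : B x r -> B x s -> r = s.
  by move=> Br Bs; apply/eqP; rewrite eq_le (B_le x) ?(B_le x).
(* The value at [x] is the supremum of the [t] with [t *: u] below [x]; beyond it, totality of [M]
   reverses the comparison. *)
have B_ex x : exists r, B x r.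
  pose A : set R := [set t | M (x - t *: u)].
  have Adown t s : A t -> s <= t -> A s.
    rewrite /A /= => At st; have -> : x - s *: u = (x - t *: u) + (t - s) *: u by module.
    by apply: MD => //; apply: (MZ _ _) => //; rewrite subr_ge0.
  have [s0 /KM Ms0] := uK x; have [t0 /KM Mt0] := uK (- x).
  have supA : has_sup A.
    split; first by exists (- t0); rewrite /A /=; move: Mt0; congr M; module.
    exists s0 => t /= At; have := MD _ _ Ms0 At.
    have -> : s0 *: u - x + (x - t *: u) = (s0 - t) *: u by module.
    by move=> /Mu_ge0; rewrite subr_ge0.
  exists (sup A) => e e0; split.
    have [t At te] := sup_adherent e0 supA.
    by apply: (Adown t) => //; exact: ltW.
  have nA : ~ A (sup A + e).
    by move=> /(ub_le_sup supA.2) h; lra.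
  have [h|] := Mtot (x - (sup A + e) *: u); first by [].
  by congr M; module.
have [f Bf] := choice B_ex.
have BD x y r s : B x r -> B y s -> B (x + y) (r + s).
  move=> Br Bs e e0; have e2 : 0 < e / 2 by lra.
  have [h1 h2] := Br _ e2; have [h3 h4] := Bs _ e2; split.
    by move: (MD _ _ h1 h3); congr M; module.
  by move: (MD _ _ h2 h4); congr M; module.
have BN x r : B x r -> B (- x) (- r).
  move=> Br e e0; have [h1 h2] := Br _ e0; split.
    by move: h2; congr M; module.
  by move: h1; congr M; module.
have BZ a x r : 0 < a -> B x r -> B (a *: x) (a * r).
  move=> a0 Br e e0; have an0 : a != 0 by rewrite gt_eqF.
  have [h1 h2] := Br (e / a) (divr_gt0 e0 a0); split.
    by move: (MZ a _ (ltW a0) h1); congr M; module.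
  by move: (MZ a _ (ltW a0) h2); congr M; module.
have B0 : B 0 0.
  move=> e e0; have := MZ e u (ltW e0) Ku1 => h.
  by split; move: h; congr M; module.
exists f; split.
- move=> a x y; apply: (B_uniq (a *: x + y)) => //; apply: BD => //.
  have [a0|a0|->] := ltgtP a 0; last by rewrite scale0r mul0r.
    have -> : a *: x = - (- a *: x) by module.
    have -> : a * f x = - (- a * f x) by ring.
    by apply/BN/BZ => //; rewrite oppr_gt0.
  exact: BZ.
- move=> x /KM Mx; apply/ler_addgt0Pr => e e0.
  have [_ h] := Bf x e e0; apply: Mu_ge0.
  by move: (MD _ _ h Mx); congr M; module.
- apply: (B_uniq u) => // e e0; have := MZ e u (ltW e0) Ku1 => h.
  by split; move: h; congr M; module.
Qed.

End Separation.

(** * Interior points of a cone as order units *)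

Section OrderUnits.
Variables (R : realType) (X : normedModType R) (C : set X).
Hypothesis hC : is_cone C.

Ltac module := module_with R X.

Lemma coneD x y : C x -> C y -> C (x + y).
Proof.
case: hC => _ _ h _ Cx Cy; rewrite -[x]scale1r -[y]scale1r.
by apply: h => //; exact: ler01.
Qed.

Lemma cone0 : C 0.
Proof.
case: hC => -[x Cx] _ h _; have := h 0 0 x x (lexx _) (lexx _) Cx Cx.
by rewrite scale0r addr0.
Qed.

Lemma coneZ (a : R) x : 0 <= a -> C x -> C (a *: x).
Proof.
case: hC => _ _ h _ a0 Cx.
by have := h a 0 x x a0 (lexx _) Cx Cx; rewrite scale0r addr0.
Qed.

Lemma cone_sum (I : Type) (r : seq I) (P : pred I) (F : I -> X) :
  (forall i, P i -> C (F i)) -> C (\sum_(i <- r | P i) F i).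
Proof. by move=> h; apply: big_ind => //; [exact: cone0|exact: coneD]. Qed.

(** Turns interiority into an order estimate. A ball of radius [e] about [z] inside the cone gives
    [M = 2 / e]; conversely the ball of radius [M^-1] lies in the cone. *)
Lemma cone_interiorP z : C° z <->
  exists2 M : R, 0 < M & forall x, C ((M * `|x|) *: z - x).
Proof.
split=> [/nbhs_normP[e /= e0 eC]|[M M0 MC]].
  exists (2 / e) => [|x]; first exact: divr_gt0.
  have [->|x0] := eqVneq x 0; first by rewrite normr0 mulr0 scale0r subr0; exact: cone0.
  have nx : 0 < `|x| by rewrite normr_gt0.
  have [en0 nxn0] : e != 0 /\ `|x| != 0 by rewrite !gt_eqF.
  have -> : (2 / e * `|x|) *: z - x = (2 / e * `|x|) *: (z - (e / (2 * `|x|)) *: x).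
    by module.
  apply: coneZ; first by rewrite mulr_ge0// divr_ge0// ltW.
  apply: eC; rewrite /= opprB addrCA subrr addr0 normrZ ger0_norm; last first.
    by rewrite divr_ge0// ?mulr_ge0// ltW.
  have -> : e / (2 * `|x|) * `|x| = e / 2 by field.
  lra.
(* The estimate at [- z] puts a positive multiple of [z] in the cone. *)
have Cz : C z.
  have k0 : 0 < M * `|z| + 1 by rewrite ltr_wpDl// mulr_ge0// ltW.
  have kn0 : M * `|z| + 1 != 0 by rewrite gt_eqF.
  have -> : z = (M * `|z| + 1)^-1 *: ((M * `|z|) *: z - - z) by module.
  by apply: coneZ; [rewrite invr_ge0 ltW|rewrite -normrN; exact: MC].
apply/nbhs_normP; exists M^-1; first by rewrite /= invr_gt0.
move=> y /=; rewrite -(ltr_pM2l M0) mulfV ?gt_eqF// => /ltW yM.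
have -> : y = (1 - M * `|z - y|) *: z + ((M * `|z - y|) *: z - (z - y)) by module.
by apply: coneD => //; apply: coneZ => //; rewrite subr_ge0.
Qed.

Lemma interior_cone z : C° z -> C z.
Proof. by move=> /nbhs_singleton. Qed.

Lemma interior_coneD z w : C° z -> C w -> C° (z + w).
Proof.
move=> /cone_interiorP[M M0 MC] Cw; apply/cone_interiorP; exists M => // x.
have -> : (M * `|x|) *: (z + w) - x = (M * `|x|) *: z - x + (M * `|x|) *: w by module.
by apply: coneD => //; apply: coneZ => //; rewrite mulr_ge0// ltW.
Qed.

Lemma interior_coneZ (a : R) z : 0 < a -> C° z -> C° (a *: z).
Proof.
move=> a0 /cone_interiorP[M M0 MC]; apply/cone_interiorP.
exists (M / a) => [|x]; first exact: divr_gt0.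
have an0 : a != 0 by rewrite gt_eqF.
by have -> : (M / a * `|x|) *: (a *: z) - x = (M * `|x|) *: z - x by module.
Qed.

(** A multiple of [z] dominates [w], so a small [e] leaves a positive multiple of [z]. A whole
    interval of [e] is given so that later arguments can shrink it. *)
Lemma interior_coneB z w : C° z ->
  exists2 d : R, 0 < d & forall e, 0 <= e <= d -> C° (z - e *: w).
Proof.
move=> Cz; have /cone_interiorP[M M0 MC] := Cz.
have k0 : 0 <= M * `|w| by rewrite mulr_ge0// ltW.
exists (2 * (M * `|w| + 1))^-1 => [|e /andP[e0 eM]].
  by rewrite invr_gt0; lra.
have -> : z - e *: w = (1 - e * (M * `|w|)) *: z + e *: ((M * `|w|) *: z - w) by module.
apply: interior_coneD; last exact: coneZ.
apply: interior_coneZ => //.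
have : e * (2 * (M * `|w| + 1)) <= 1.
  by rewrite -ler_pdivlMr ?div1r//; lra.
nra.
Qed.

(** Closedness of the cone: [x] is the limit of [x + e *: w] as [e] tends to 0. *)
Lemma cone_archimedean x w : (forall e : R, 0 < e -> C (x + e *: w)) -> C x.
Proof.
case: hC => _ clC _ _ h; apply: clC => A /nbhs_normP[e /= e0 eA].
have k0 : 0 < `|w| + 1 by rewrite ltr_wpDl.
have d0 : 0 < e / 2 / (`|w| + 1) by rewrite divr_gt0// divr_gt0.
exists (x + (e / 2 / (`|w| + 1)) *: w); split; first exact: h.
apply: eA; rewrite /= opprD addNKr normrN normrZ gtr0_norm//.
rewrite mulrAC ltr_pdivrMr//.
have : 0 <= e * `|w| by rewrite mulr_ge0// ltW.
nra.
Qed.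

(** Normality for two-sided bounds: it applies to [0 <= w + x <= 2 *: w], and subtracting [w] costs
    one more norm of [w]. *)
Lemma normal_cone_bound c x w : (forall x y, cone_le C 0 x -> cone_le C x y -> `|x| <= c * `|y|) ->
  C (w - x) -> C (w + x) -> `|x| <= (2 * c + 1) * `|w|.
Proof.
move=> hc h1 h2.
have: `|w + x| <= c * `|2 *: w|.
  apply: hc; rewrite /cone_le ?subr0//.
  by have -> : 2 *: w - (w + x) = w - x by module.
rewrite normrZ ger0_norm// => h.
have : `|x| <= `|w + x| + `|w|.
  have {1}-> : x = (w + x) - w by module.
  exact: ler_normB.
lra.
Qed.

End OrderUnits.

(** * Geometric decay *)

Lemma geometric_bound_cvg0 (R : realType) (V : normedModType R) (u : nat -> V)
    (M q : R) : 0 <= q < 1 -> (forall n, `|u n| <= M * q ^+ n) ->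
  u n @[n --> \oo] --> (0 : V).
Proof.
move=> /andP[q0 q1] uM; apply/cvgr0Pnorm_lt => e e0.
have : geometric M q n @[n --> \oo] --> (0 : R).
  by apply: cvg_geometric; rewrite ger0_norm.
move=> /cvgr0Pnorm_lt/(_ _ e0); apply: filterS => n /=.
by apply: le_lt_trans; apply: le_trans (ler_norm _); exact: uM.
Qed.

Lemma geometric_eventually_lt (R : realType) (q t e : R) :
  0 <= q < 1 -> 0 < e -> exists n, t * q ^+ n < e.
Proof.
move=> /andP[q0 q1] e0.
have /cvgrPdist_lt/(_ _ e0)[n _ h] : geometric t q n @[n --> \oo] --> (0 : R).
  by apply: cvg_geometric; rewrite ger0_norm.
exists n; have := h n (leqnn n); rewrite /= sub0r normrN.
by apply: le_lt_trans; exact: ler_norm.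
Qed.

(** * Positive operators on an ordered normed space *)

Section PositiveOperators.
Variables (R : realType) (X : normedModType R) (C : set X) (T : {linear X -> X}).
Hypotheses (hC : is_cone C) (nC : normal_cone C) (pT : positive_op C T).

Ltac module := module_with R X.

Let CD := coneD R X C hC.
Let CZ := coneZ R X C hC.
Let C_0 := cone0 R X C hC.

Let TZ a x : T (a *: x) = a *: T x := linearZZ T a x.
Let TD x y : T (x + y) = T x + T y := linearD T x y.
Let TB x y : T (x - y) = T x - T y := linearB T x y.

Lemma cone_operator x : C x -> C (T x).
Proof. by move=> Cx; apply: pT; exists x. Qed.

Lemma cone_iter n x : C x -> C (iter n T x).
Proof. by move=> Cx; elim: n => //= n; exact: cone_operator. Qed.

Lemma iter_linearB n (a : R) (x y : X) :
  iter n T (a *: x - y) = a *: iter n T x - iter n T y.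
Proof. by elim: n => //= n ->; rewrite TB TZ. Qed.

(** [y] is [a] times the truncated Neumann series of [(a - T)^-1 z], so the left side telescopes. *)
Lemma neumann_sumE (a : R) N (z : X) : a != 0 ->
  let y := \sum_(0 <= j < N) a^-1 ^+ j *: iter j T z in
  a *: y - T y = a *: (z - a^-1 ^+ N *: iter N T z).
Proof.
move=> a0 /=; rewrite scaler_sumr linear_sum -sumrB.
pose g j := - a *: (a^-1 ^+ j *: iter j T z).
rewrite (eq_bigr (fun j => g j.+1 - g j)); last first.
  by move=> j _; rewrite /g TZ exprS; module.
by rewrite telescope_sumr// /g /= expr0; module.
Qed.

Lemma scaled_le_of_ll z : C° z -> C° (z - T z) ->
  exists2 l : R, 0 < l < 1 & C (l *: z - T z).
Proof.
move=> Cz CTz; have [d d0 dC] := interior_coneB R X C hC (z - T z) z CTz.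
(* The cap [2^-1] keeps [l = 1 - e] positive. *)
pose e := Num.min d 2^-1.
have e0 : 0 < e by rewrite lt_min d0 invr_gt0 ltr0n.
have [ed e2] : e <= d /\ e <= 2^-1 by rewrite !ge_min !lexx orbT.
exists (1 - e); first by apply/andP; split; lra.
have /interior_cone : C° (z - T z - e *: z) by apply: dC; rewrite ltW.
by congr C; module.
Qed.

(** * Consequences of [T z <= l z] at an interior point [z] *)

Section SubEigenvector.
Variables (z : X) (l : R).
Hypotheses (Cz : C° z) (l0 : 0 <= l) (lz : C (l *: z - T z)).

Lemma iter_le_expn n : C (l ^+ n *: z - iter n T z).
Proof.
elim: n => [|n IH]; first by rewrite expr0 scale1r subrr.
have -> : l ^+ n.+1 *: z - iter n.+1 T z =
    l ^+ n *: (l *: z - T z) + T (l ^+ n *: z - iter n T z).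
  by rewrite TB TZ exprS; module.
by apply: CD; [apply: CZ => //; exact: exprn_ge0|exact: cone_operator].
Qed.

(** [T^n] carries the order bounds of [x] by multiples of [z] to the same bounds scaled by [l ^+ n];
    normality turns them into a norm bound. *)
Lemma norm_iter_le :
  exists2 K : R, 0 <= K & forall n x, `|iter n T x| <= K * l ^+ n * `|x|.
Proof.
have /(cone_interiorP R X C hC)[M M0 MC] := Cz.
have [c [c0 hc]] := nC.
have half n (x : X) : C ((l ^+ n * (M * `|x|)) *: z - iter n T x).
  have -> : (l ^+ n * (M * `|x|)) *: z - iter n T x =
     (M * `|x|) *: (l ^+ n *: z - iter n T z) + iter n T ((M * `|x|) *: z - x).
    by rewrite iter_linearB; module.
  apply: CD; last exact: cone_iter.
  by apply: CZ; [rewrite mulr_ge0// ltW|exact: iter_le_expn].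
exists ((2 * c + 1) * M * `|z|) => [|n x].
  by rewrite !mulr_ge0// ?ltW//; lra.
have -> : (2 * c + 1) * M * `|z| * l ^+ n * `|x| =
    (2 * c + 1) * `|(l ^+ n * (M * `|x|)) *: z|.
  rewrite normrZ ger0_norm; first by ring.
  by rewrite mulr_ge0 ?exprn_ge0// mulr_ge0// ltW.
apply: (normal_cone_bound R X C) => //.
have := half n (- x); rewrite normrN.
have -> : iter n T (- x) = - iter n T x.
  by elim: (n) => //= k ->; rewrite linearN.
by rewrite opprK.
Qed.

(* A functional [f <= T' f] satisfies [f z <= f (T z) <= l * f z], so it
   vanishes at the order unit [z], hence everywhere. *)
Lemma dual_small_gain (f : X -> R) : l < 1 -> dual_elt f -> dual_pos C f ->
  dual_pos C (fun x => dual_op T f x - f x) -> forall x, f x = 0.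
Proof.
move=> l1 [linf _] fpos fT x.
have /(cone_interiorP R X C hC)[M M0 MC] := Cz.
have fP (a : R) u v : f (a *: u + v) = a * f u + f v by exact: linf.
have fN u : f (- u) = - f u.
  have f0 : f 0 = 0.
    by have := fP 1 0 0; rewrite scale1r addr0 mul1r => h; lra.
  by have := fP (-1) u 0; rewrite addr0 scaleN1r f0 => ->; ring.
have fz : f z <= 0.
  have := fpos _ lz; rewrite fP fN; have := fT _ (interior_cone _ _ _ _ Cz); rewrite /dual_op.
  by move=> h1 h2; nra.
have fle u : f u <= 0.
  have := fpos _ (MC u); rewrite fP fN => h.
  have : 0 <= M * `|u| by rewrite mulr_ge0// ltW.
  by nra.
by apply/eqP; rewrite eq_le fle -oppr_le0 -fN fle.
Qed.

(** If the inequality held at [x], then [x <= T x + s *: z] with [s] proportional to [eta] and to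
    the norm of [x]. Iterating gives [x <= (s / (1 - l)) *: z], and by normality the norm of [x]
    would be strictly less than itself. *)
Lemma uniform_small_gain (w : X) : l < 1 ->
  exists2 eta : R, 0 < eta &
    forall x, C x -> x <> 0 -> ~ cone_le C (x - (eta * `|x|) *: w) (T x).
Proof.
move=> l1; have [c [c0 hc]] := nC; have Cz' := interior_cone _ _ _ _ Cz.
have /(cone_interiorP R X C hC)[M M0 MC] := Cz.
have m0 : 0 <= M * `|w| by rewrite mulr_ge0// ltW.
have b0 : 0 <= c * (M * `|w|) * `|z| by rewrite !mulr_ge0// ltW.
have dl : 0 < 1 - l by lra.
have dln0 : 1 - l != 0 by rewrite gt_eqF.
(* With [b = c * (M * |w|) * |z|], the final bound on the norm of [x] is that norm times
   [b / (b + 1)]. *)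
pose eta := (1 - l) / (c * (M * `|w|) * `|z| + 1).
have eta0 : 0 < eta by rewrite divr_gt0//; lra.
exists eta => // x Cx x0; rewrite /cone_le => CTx.
pose s := eta * `|x| * (M * `|w|).
have s0 : 0 <= s by rewrite mulr_ge0// mulr_ge0// ltW.
have CTs : C (T x - x + s *: z).
  have -> : T x - x + s *: z =
     (T x - (x - (eta * `|x|) *: w)) + (eta * `|x|) *: ((M * `|w|) *: z - w).
    by rewrite /s; module.
  by apply: CD => //; apply: CZ => //; rewrite mulr_ge0// ltW.
(* A bound [x <= t *: z] improves to [x <= (l * t + s) *: z]; [s / (1 - l)] is the fixed point of
   this update. *)
have step n : C ((l ^+ n * (M * `|x|) + s / (1 - l)) *: z - x).
  elim: n => [|n IH].
    have -> : (l ^+ 0 * (M * `|x|) + s / (1 - l)) *: z - x =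
       ((M * `|x|) *: z - x) + (s / (1 - l)) *: z by rewrite expr0; module.
    by apply: CD => //; apply: CZ => //; rewrite divr_ge0// ltW.
  set t := (X in C (X *: z - x)) in IH.
  have -> : (l ^+ n.+1 * (M * `|x|) + s / (1 - l)) *: z - x =
     (T x - x + s *: z) + (T (t *: z - x) + t *: (l *: z - T z)).
    by rewrite TB TZ /t exprS; module.
  apply: CD => //; apply: CD; first exact: cone_operator.
  apply: CZ => //; apply: addr_ge0; last by rewrite divr_ge0// ltW.
  by rewrite mulr_ge0 ?exprn_ge0// mulr_ge0// ltW.
have Cs : C ((s / (1 - l)) *: z - x).
  apply: (cone_archimedean R X C hC _ z) => e e0.
  have [n hn] : exists n, (M * `|x|) * l ^+ n < e.
    by apply: geometric_eventually_lt => //; rewrite l0.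
  have -> : (s / (1 - l)) *: z - x + e *: z =
    ((l ^+ n * (M * `|x|) + s / (1 - l)) *: z - x) + (e - M * `|x| * l ^+ n) *: z.
    by module.
  by apply: CD => //; apply: CZ => //; lra.
have := hc x ((s / (1 - l)) *: z).
rewrite /cone_le subr0 => /(_ Cx Cs).
rewrite normrZ ger0_norm; last by rewrite divr_ge0// ltW.
have nx : 0 < `|x| by rewrite normr_gt0; exact/eqP.
have -> : c * (s / (1 - l) * `|z|) =
    `|x| * ((c * (M * `|w|) * `|z|) / (c * (M * `|w|) * `|z| + 1)).
  by rewrite /s /eta; field; rewrite dln0 gt_eqF//; lra.
rewrite ler_pMr// ler_pdivlMr; lra.
Qed.

End SubEigenvector.

(** * Existence of sub-eigenvectors *)

(** Order analogue of the renorming that turns an operator with a contractive power into a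
    contraction: the weighted orbit sum of [z] contracts under [T] itself. *)
Lemma sub_eigenvector_of_iter z k : C° z -> C (2^-1 *: z - iter k T z) ->
  exists2 y, C° y & exists2 l : R, 0 < l < 1 & C (l *: y - T y).
Proof.
move=> Cz; case: k => [|k] /= hk.
  (* For [k = 0] the assumption reads [z <= 2^-1 *: z], so [- z] is in the cone as well. *)
  have z0 : z = 0.
    case: hC => _ _ _; apply; first exact: interior_cone.
    have -> : - z = 2 *: (2^-1 *: z - z) by module.
    exact: CZ.
  exists z => //; exists 2^-1; first by apply/andP; split; lra.
  by rewrite z0 (linear0 T) scaler0 subrr.
(* The sum of the [q^-j T^j z], [j < k], works once [q^k >= 1/2]. *)
pose q : R := 1 - (2 * k.+1%:R)^-1.
(* Used for [a = 1 - q] and [n = k.+1], where the left side is [1 / 2]. *)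
have bernoulli (a : R) n : 0 <= a <= 1 -> 1 - n%:R * a <= (1 - a) ^+ n.
  move=> /andP[a0 a1]; elim: n => [|n IH]; first by rewrite expr0; lra.
  rewrite exprS -natr1; have n0 : 0 <= n%:R * (a * a) by rewrite !mulr_ge0.
  have a1' : 0 <= 1 - a by lra.
  have := ler_wpM2l a1' IH; move: (n%:R) n0 => m n0; nra.
have k0 : 1 <= k.+1%:R :> R by rewrite ler1n.
have i0 : 0 < (2 * k.+1%:R)^-1 :> R by rewrite invr_gt0; lra.
have i1 : (2 * k.+1%:R)^-1 <= 2^-1 :> R by rewrite lef_pV2 ?posrE; lra.
have [q0 q1] : 0 < q /\ q < 1.
  by rewrite /q; move: (_^-1) i0 i1 => i i0 i1; split; lra.
have qn0 : q != 0 by rewrite gt_eqF.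
have qk : 2^-1 <= q ^+ k.+1.
  apply: le_trans (bernoulli _ _ _); last first.
    by rewrite ltW//=; move: (_^-1) i1 => i i1; lra.
  have -> : k.+1%:R * (2 * k.+1%:R)^-1 = 2^-1 :> R by field; rewrite gt_eqF//; lra.
  lra.
have qk0 : 0 < q ^+ k.+1 by exact: exprn_gt0.
exists (\sum_(0 <= j < k.+1) q^-1 ^+ j *: iter j T z).
  rewrite big_nat_recl// expr0 scale1r; apply: interior_coneD => //.
  apply: cone_sum => // j _; apply: CZ; first by rewrite exprn_ge0// invr_ge0 ltW.
  by apply: cone_iter; exact: interior_cone.
exists q; first by rewrite q0.
rewrite neumann_sumE//; apply: CZ; first exact: ltW.
have qkn0 : q ^+ k.+1 != 0 by rewrite gt_eqF.
have -> : z - q^-1 ^+ k.+1 *: iter k.+1 T z =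
   (q ^+ k.+1)^-1 *: ((q ^+ k.+1 - 2^-1) *: z + (2^-1 *: z - iter k.+1 T z)).
  by rewrite exprVn; module.
apply: CZ; first by rewrite invr_ge0 ltW.
by apply: CD => //; apply: CZ; [rewrite subr_ge0|exact: interior_cone].
Qed.

(** The strict inequality survives a small decrease of [l], as the continuation requires. *)
Definition sub_eigenvalue (l : R) := exists2 y, C° y & C° (l *: y - T y).

(** A truncated Neumann sum stands in for [(l - T)^-1 z]: an error of at most [z / 2] is harmless
    later, and no limit has to exist. *)
Lemma approximate_resolvent l z : 0 < l -> sub_eigenvalue l -> C° z ->
  exists x, [/\ C x, C (z - (l *: x - T x)) & C (l *: x - T x - 2^-1 *: z)].
Proof.
move=> l0 [y Cy Cly] Cz.
have [d d0 dC] := interior_coneB R X C hC _ y Cly.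
(* Strictness gives [T y <= (l - e) *: y], hence decay of [l^-n T^n y] at rate [(l - e) / l]; the
   cap keeps [l - e] positive. *)
pose e := Num.min d (l / 2).
have e0 : 0 < e by rewrite lt_min d0 divr_gt0.
have [ed el] : e <= d /\ e <= l / 2 by rewrite !ge_min !lexx orbT.
have my : C ((l - e) *: y - T y).
  have /interior_cone : C° (l *: y - T y - e *: y) by apply: dC; rewrite ltW.
  by congr C; module.
(* [y] and [z] dominate each other up to constants, so the decay passes from [y] to [z]. *)
have [M M0 MC] : exists2 M : R, 0 < M & forall x, C ((M * `|x|) *: y - x).
  exact/cone_interiorP.
have [N N0 NC] : exists2 M : R, 0 < M & forall x, C ((M * `|x|) *: z - x).
  exact/cone_interiorP.
have ln0 : l != 0 by rewrite gt_eqF.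
(* The remainder [l^-n T^n z] of the Neumann sum is at most [z / 2]. *)
have [n hn] : exists n, (M * `|z| * (N * `|y|)) * ((l - e) / l) ^+ n < 2^-1.
  apply: geometric_eventually_lt; last by lra.
  by rewrite ltr_pdivrMr// divr_ge0 ?ltW//; lra.
pose v := l^-1 ^+ n *: iter n T z.
have Cv : C v.
  by apply: CZ; [rewrite exprn_ge0// invr_ge0 ltW|apply: cone_iter; exact: interior_cone].
have vz : C (2^-1 *: z - v).
  pose a := M * `|z|; pose b := l^-1 ^+ n; pose m := (l - e) ^+ n.
  have mge0 : 0 <= m by rewrite exprn_ge0//; lra.
  have bge0 : 0 <= b by rewrite exprn_ge0// invr_ge0 ltW.
  have age0 : 0 <= a by rewrite mulr_ge0// ltW.
  have h1 : C (a *: iter n T y - iter n T z).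
    rewrite -iter_linearB; exact/cone_iter/MC.
  have h2 : C (m *: y - iter n T y).
    by apply: iter_le_expn => //; lra.
  have -> : 2^-1 *: z - v = (2^-1 - a * (N * `|y|) * ((l - e) / l) ^+ n) *: z
      + (b * a * m) *: ((N * `|y|) *: z - y)
      + (b * a) *: (m *: y - iter n T y) + b *: (a *: iter n T y - iter n T z).
    by rewrite /v -/b expr_div_n -[l ^- n]exprVn -/b -/m; module.
  apply: CD; last exact: CZ.
  apply: CD; last by apply: CZ => //; rewrite mulr_ge0.
  apply: CD; last by apply: CZ => //; rewrite mulr_ge0// mulr_ge0.
  by apply: CZ; [rewrite subr_ge0 ltW|exact: interior_cone].
exists (l^-1 *: \sum_(0 <= j < n) l^-1 ^+ j *: iter j T z).
set S := \sum_(0 <= j < n) _.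
have -> : l *: (l^-1 *: S) - T (l^-1 *: S) = z - v.
  rewrite TZ.
  have -> : l *: (l^-1 *: S) - l^-1 *: T S = l^-1 *: (l *: S - T S) by module.
  by rewrite /S neumann_sumE// -/v; module.
split.
- apply: CZ; first by rewrite invr_ge0 ltW.
  apply: cone_sum => // j _; apply: CZ; first by rewrite exprn_ge0// invr_ge0 ltW.
  by apply: cone_iter; exact: interior_cone.
- by have -> : z - (z - v) = v by module.
- by have -> : z - v - 2^-1 *: z = 2^-1 *: z - v by module.
Qed.

(* The set of sub-eigenvalues is open, upward closed and nonempty.  A bound on
   the approximate resolvents near the infimum [l0 >= 1] of its part above [1]
   makes [l0] itself a sub-eigenvalue. *)
Lemma sub_eigenvalue_continuation z : C° z ->
  (forall l0 : R, 1 <= l0 -> exists2 d : R, 0 < d & exists K : R,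
     forall l x, l0 < l <= l0 + d -> C x -> C (z - (l *: x - T x)) ->
       C (l *: x - T x - 2^-1 *: z) -> `|x| <= K) ->
  sub_eigenvalue 1.
Proof.
move=> Cz bnd.
have [M M0 MC] : exists2 M : R, 0 < M & forall x, C ((M * `|x|) *: z - x).
  exact/cone_interiorP.
have up l m : l <= m -> sub_eigenvalue l -> sub_eigenvalue m.
  move=> lm [y Cy ly]; exists y => //.
  have -> : m *: y - T y = l *: y - T y + (m - l) *: y by module.
  by apply: interior_coneD => //; apply: CZ; [rewrite subr_ge0|exact: interior_cone].
pose A : set R := [set l | 1 <= l /\ sub_eigenvalue l].
have infA : has_inf A.
  split; last by exists 1 => l [].
  exists (M * `|T z| + 1); split; first by rewrite lerDr mulr_ge0// ltW.
  exists z => //.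
  have -> : (M * `|T z| + 1) *: z - T z = z + ((M * `|T z|) *: z - T z) by module.
  exact: interior_coneD.
have l1 : 1 <= inf A by apply: lb_le_inf; [exact: infA.1|move=> l []].
set l0 := inf A in l1.
have sub_l0 : sub_eigenvalue l0.
  have [d d0 [K hK]] := bnd _ l1.
  have k0 : 0 < 4 * M * (`|K| + 1) by rewrite !mulr_gt0// ltr_wpDl.
  (* Going from [l0 + e] back to [l0] costs [e *: x], which this choice keeps below [z / 4], within
     the available slack [z / 2]. *)
  pose e := Num.min d (4 * M * (`|K| + 1))^-1.
  have e0 : 0 < e by rewrite lt_min d0 invr_gt0.
  have [ed eK] : e <= d /\ e <= (4 * M * (`|K| + 1))^-1 by rewrite !ge_min !lexx orbT.
  have [l' [_ subl']] := inf_adherent e0 infA; rewrite -/l0 => l'e.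
  pose l := l0 + e.
  have subl : sub_eigenvalue l by apply: up subl'; exact: ltW.
  have lpos : 0 < l by rewrite /l; lra.
  have [x [Cx xz zx]] := approximate_resolvent _ _ lpos subl Cz.
  have xK : `|x| <= `|K|.
    apply: le_trans (ler_norm _); apply: hK xz zx => //.
    by rewrite /l ltrDl e0 lerD2l.
  have ln0 : l != 0 by rewrite gt_eqF.
  exists x.
    have -> : x = l^-1 *: (2^-1 *: z + (l *: x - T x - 2^-1 *: z + T x)) by module.
    apply: interior_coneZ; rewrite ?invr_gt0//; apply: interior_coneD => //.
      by apply: interior_coneZ => //; lra.
    by apply: CD => //; exact: cone_operator.
  have -> : l0 *: x - T x = (2^-1 - e * (M * `|x|)) *: z +
     ((l *: x - T x - 2^-1 *: z) + e *: ((M * `|x|) *: z - x)).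
    by rewrite /l; module.
  apply: interior_coneD => //; last by apply: CD => //; apply: CZ => //; exact: ltW.
  apply: interior_coneZ => //.
  have : e * (4 * M * (`|K| + 1)) <= 1 by rewrite -ler_pdivlMr// div1r.
  have : e * (M * `|x|) <= e * (M * (`|K| + 1)).
    by rewrite !ler_wpM2l ?ltW//; lra.
  have : 0 < e * (M * (`|K| + 1)) by rewrite !mulr_gt0// ltr_wpDl.
  lra.
have [->//|] := eqVneq 1 l0; rewrite neq_lt => /orP[l10|]; last by lra.
exfalso.
(* If [l0 > 1], the strict inequality at [l0] persists at some [l0 - e >= 1], against the choice of
   [l0] as infimum. *)
have [y Cy ly] := sub_l0.
have [d d0 dC] := interior_coneB R X C hC _ y ly.
pose e := Num.min d (l0 - 1).
have e0 : 0 < e by rewrite lt_min d0 subr_gt0.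
have [ed el] : e <= d /\ e <= l0 - 1 by rewrite !ge_min !lexx orbT.
have : A (l0 - e).
  split; first by lra.
  exists y => //; have : C° (l0 *: y - T y - e *: y) by apply: dC; rewrite ltW.
  by congr (interior _ _); module.
by move=> /(ge_inf infA.2); rewrite -/l0; lra.
Qed.

(** For [l > 1], [l *: x - T x <= z] gives [T x >= x - z]. Once the norm of [x] exceeds [eta^-1]
    this contradicts the assumption, so [eta^-1] serves as bound for every [l0]. *)
Lemma sub_eigenvalue_of_uniform_small_gain z (eta : R) : C° z -> 0 < eta ->
  (forall x, C x -> x <> 0 -> ~ cone_le C (x - (eta * `|x|) *: z) (T x)) ->
  sub_eigenvalue 1.
Proof.
move=> Cz eta0 h; apply: (sub_eigenvalue_continuation _ Cz) => l0 l01.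
exists 1 => //; exists eta^-1 => l x /andP[l0l _] Cx xz _.
rewrite leNgt; apply/negP => xeta.
have xpos : 0 < `|x| by apply: lt_trans xeta; rewrite invr_gt0.
apply: (h x Cx); first by apply/eqP; rewrite -normr_gt0.
rewrite /cone_le.
have -> : T x - (x - (eta * `|x|) *: z) = (l - 1) *: x + ((z - (l *: x - T x)) +
   (eta * `|x| - 1) *: z) by module.
apply: CD; first by apply: CZ => //; lra.
apply: CD => //; apply: CZ; last exact: interior_cone.
by rewrite subr_ge0 mulrC -ler_pdivrMr// div1r ltW.
Qed.

(** Normality bounds [l *: x - T x], which lies between 0 and [z]. Replacing [l] by [l0] changes it
    by [(l - l0) *: x], absorbed in the estimate at [l0] when [l - l0 <= (2 * s)^-1]. *)
Lemma sub_eigenvalue_of_resolvent z : C° z ->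
  (forall l : R, 1 <= l -> exists2 s : R, 0 < s & forall x, `|x| <= s * `|l *: x - T x|) ->
  sub_eigenvalue 1.
Proof.
move=> Cz h; apply: (sub_eigenvalue_continuation _ Cz) => l0 l01.
have [s s0 hs] := h _ l01; have [c [c0 hc]] := nC.
exists (2 * s)^-1; first by rewrite invr_gt0 mulr_gt0.
exists (2 * s * (c * `|z|)) => l x /andP[l0l lle] Cx xz zx.
have Cw : C (l *: x - T x).
  have -> : l *: x - T x = (l *: x - T x - 2^-1 *: z) + 2^-1 *: z by module.
  by apply: CD => //; apply: CZ; [lra|exact: interior_cone].
have nw : `|l *: x - T x| <= c * `|z|.
  by apply: hc; rewrite /cone_le ?subr0.
have := hs x.
have -> : l0 *: x - T x = (l *: x - T x) - (l - l0) *: x by module.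
have := ler_normB (l *: x - T x) ((l - l0) *: x).
rewrite normrZ gtr0_norm ?subr_gt0// => h1 h2.
have h3 : (l - l0) * (2 * s) <= 1.
  by rewrite -ler_pdivlMr ?mulr_gt0// div1r; lra.
have h4 : s * ((l - l0) * `|x|) <= 2^-1 * `|x|.
  by rewrite mulrA ler_wpM2r//; lra.
have h5 : s * `|l *: x - T x| <= s * (c * `|z|) by rewrite ler_wpM2l// ltW.
have h6 := ler_wpM2l (ltW s0) h1.
lra.
Qed.

(** Let [K] consist of the [c + (T z - z)] with [c] and [z] in the cone. If [- u] is in [K], then
    [z - T z] is interior for some [z] in the cone. Otherwise a functional nonnegative on [K] with
    value 1 at [u] violates the assumption. *)
Lemma sub_eigenvalue_of_dual_small_gain u : C° u ->
  (forall f : X -> R, dual_elt f -> dual_pos C f -> ~ (forall x, f x = 0) ->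
     ~ dual_pos C (fun x => dual_op T f x - f x)) ->
  sub_eigenvalue 1.
Proof.
move=> Cu h; apply: contrapT => nsub.
have [M M0 MC] : exists2 M : R, 0 < M & forall x, C ((M * `|x|) *: u - x).
  exact/cone_interiorP.
pose K : set X := [set v | exists c z, [/\ C c, C z & v = c + (T z - z)]].
have CK v : C v -> K v.
  by move=> Cv; exists v, 0; split => //; rewrite linear0 subr0 addr0.
have cK : convex_cone R X K.
  split; first by apply: CK.
  - move=> v w [c [z [Cc Cz ->]]] [d [y [Cd Cy ->]]].
    exists (c + d), (z + y); split; [exact: CD|exact: CD|].
    by rewrite TD; module.
  - move=> a v a0 [c [z [Cc Cz ->]]].
    exists (a *: c), (a *: z); split; [exact: CZ|exact: CZ|].
    by rewrite TZ; module.
have Ku : ~ K (- u).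
  move=> [c [z [Cc Cz uE]]]; apply: nsub.
  have CzT : C° (z - T z).
    have -> : z - T z = u + c.
      by have -> : u = - (c + (T z - z)) by [rewrite -uE opprK]; module.
    exact: interior_coneD.
  have [d d0 dC] := interior_coneB R X C hC _ (- (u - T u)) CzT.
  (* Adding [d *: u] moves [z] into the interior while the strict inequality persists. *)
  exists (z + d *: u).
    by rewrite addrC; apply: interior_coneD => //; exact: interior_coneZ.
  have : C° (z - T z - d *: - (u - T u)) by apply: dC; rewrite lexx ltW.
  by congr (interior _ _); rewrite TD TZ; module.
have [x|f [fP fK fu]] := positive_functional R X K u cK Ku.
  by exists (M * `|x|); exact/CK/MC.
have f0 : f 0 = 0.
  by have := fP 1 0 0; rewrite scale1r addr0 mul1r => e; lra.
have fN x : f (- x) = - f x.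
  by have := fP (-1) x 0; rewrite addr0 scaleN1r f0 => ->; ring.
(* Continuity of [f] comes from positivity, since [u] is an order unit. *)
have fle x : f x <= M * `|x|.
  by have := fK _ (CK _ (MC x)); rewrite fP fN fu; lra.
have flin : linear (f : X -> R^o) by move=> a x y; exact: fP.
pose F : {linear X -> R^o} := HB.pack f (GRing.isLinear.Build _ _ _ _ _ flin).
apply: (h f).
- split=> //; have : continuous F; last by [].
  apply: bounded_linear_continuous; apply/linear_boundedP.
  exists M; split; first exact: num_real.
  move=> r Mr x; apply: le_trans (ler_wpM2r _ (ltW Mr)) => //.
  rewrite /= ler_norml fle andbT lerNl -fN; apply: le_trans (fle _) _.
  by rewrite normrN.
- by move=> x Cx; exact/fK/CK.
- by move=> /(_ u); rewrite fu; lra.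
- move=> x Cx; rewrite /dual_op.
  have : 0 <= f (0 + (T x - x)) by apply: fK; exists 0, x.
  by have -> : 0 + (T x - x) = 1 *: T x + - x by [module]; rewrite fP fN mul1r.
Qed.

End PositiveOperators.

(** * Neumann series and bounded inverses *)

Lemma continuous_of_bound (R : realType) (V W : normedModType R)
    (f : {linear V -> W}) (M : R) :
  (forall x, `|f x| <= M * `|x|) -> continuous f.
Proof.
move=> fM; apply: bounded_linear_continuous; apply/linear_boundedP.
exists M; split; first exact: num_real.
by move=> r Mr x; apply: le_trans (ler_wpM2r _ (ltW Mr)).
Qed.

Section NeumannSeries.
Variables (R : realType) (Y : normedModType R) (V : {linear Y -> Y}) (K q : R).
Hypotheses (q01 : 0 <= q < 1)
  (absolutely_cvg : forall u : nat -> Y,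
     (exists M, forall n, `|u n| <= M * q ^+ n) ->
     exists l : Y, series u n @[n --> \oo] --> l)
  (V_le : forall n (p : Y), `|iter n V p| <= K * q ^+ n * `|p|).

Let VB (x y : Y) : V (x - y) = V x - V y := linearB V x y.

Let VD (x y : Y) : V (x + y) = V x + V y := linearD V x y.

Let s (p : Y) n := series (fun k => iter k V p) n.

Lemma neumann_partial_sum (p : Y) n : s p n - V (s p n) = p - iter n V p.
Proof.
rewrite /s; elim: n => [|n IH]; first by rewrite !seriesEnat /= !big_geq// (linear0 V) !subrr.
rewrite seriesSr VD opprD addrACA IH /= addrA subrK //.
Qed.

Lemma neumann_partial_sumB (p : Y) n : s (p - V p) n = p - iter n V p.
Proof.
rewrite -neumann_partial_sum /s; elim: n => [|n IH].
  by rewrite !seriesEnat /= !big_geq// (linear0 V) !subrr.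
rewrite !seriesSr VD opprD addrACA IH; congr (_ + _).
by elim: n {IH} => //= n ->; rewrite VB.
Qed.

Lemma neumann_remainder (p : Y) : (p - iter n V p) @[n --> \oo] --> p.
Proof.
rewrite -[X in _ --> X]subr0; apply: cvgB; first exact: cvg_cst.
by apply: (geometric_bound_cvg0 _ _ _ (K * `|p|) _ q01) => n; rewrite mulrAC.
Qed.

(** [S p] is the sum of the [V^n p], continuous by the geometric bound on partial sums. Completeness
    enters only through [absolutely_cvg], which is checked componentwise on [X * X] below. *)
Lemma neumann_inverse : exists S : Y -> Y,
  [/\ continuous S, cancel (fun p => p - V p) S & cancel S (fun p => p - V p)].
Proof.
have cvgs p : exists l : Y, s p n @[n --> \oo] --> l.
  by apply: absolutely_cvg; exists (K * `|p|) => n; rewrite mulrAC; exact: V_le.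
have [S hS] := choice cvgs.
have cV : continuous V.
  by apply: (@continuous_of_bound _ _ _ _ (K * q)) => x; have := V_le 1 x; rewrite expr1.
have SK : cancel (fun p => p - V p) S.
  move=> p; apply: (norm_cvg_unique (hS _)).
  have -> : s (p - V p) = fun n => p - iter n V p.
    by apply/funext => n; exact: neumann_partial_sumB.
  exact: neumann_remainder.
have KS : cancel S (fun p => p - V p).
  move=> p /=.
  have h : (s p n - V (s p n)) @[n --> \oo] --> S p - V (S p).
    by apply: cvgB => //; apply: continuous_cvg; [exact: cV|exact: hS].
  apply: (norm_cvg_unique h).
  rewrite (_ : (fun n => _) = (fun n => p - iter n V p)); last first.
    by apply/funext => n; exact: neumann_partial_sum.
  exact: neumann_remainder.
exists S; split => //.
have linI : linear (fun p => p - V p).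
  by move=> a x y /=; rewrite linearP scalerBr opprD addrACA.
pose I : {linear Y -> Y} := HB.pack (fun p => p - V p) (GRing.isLinear.Build _ _ _ _ _ linI).
have linS : linear S by apply: (@can2_linear _ _ _ I).
pose Sl : {linear Y -> Y} := HB.pack S (GRing.isLinear.Build _ _ _ _ _ linS).
have : continuous Sl; last by [].
case/andP: q01 => q0 q1.
apply: (@continuous_of_bound _ _ _ _ (`|K| / (1 - q))) => p /=.
have -> : `|S p| = lim (`|s p n| @[n --> \oo]) by apply/esym/cvg_lim => //; exact: cvg_norm.
apply: limr_le; first by apply/cvg_ex; exists `|S p|; exact: cvg_norm.
apply: nearW => n; rewrite /s seriesEnat /=.
apply: le_trans (ler_norm_sum _ _ _) _.
apply: (@le_trans _ _ (\sum_(0 <= i < n) (`|K| * `|p|) * q ^+ i)).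
  apply: ler_sum => i _; apply: le_trans (V_le _ _) _.
  rewrite [leRHS]mulrAC; apply: ler_wpM2r => //; apply: ler_wpM2r; first exact: exprn_ge0.
  exact: ler_norm.
have q1n : q != 1 by rewrite lt_eqF.
have := @geometric_seriesE R (`|K| * `|p|) q q1n.
rewrite seriesEnat => /(congr1 (fun f => f n)) /= ->.
rewrite [leRHS]mulrAC; apply: ler_wpM2r; first by rewrite invr_ge0 subr_ge0 ltW.
by apply: ler_piMr; [rewrite mulr_ge0|rewrite gerBl exprn_ge0].
Qed.

End NeumannSeries.

Lemma geometric_bound_series_cvg (R : realType) (X : completeNormedModType R)
    (u : nat -> X) (M q : R) : 0 <= q < 1 ->
  (forall n, `|u n| <= M * q ^+ n) -> cvgn (series u).
Proof.
move=> /andP[q0 q1] uM; apply: normed_cvg.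
apply: (@series_le_cvg _ _ (geometric M q)) => //.
- by move=> n /=.
- by move=> n; exact: le_trans (normr_ge0 _) (uM n).
- by apply: is_cvg_geometric_series; rewrite ger0_norm.
Qed.

Lemma geometric_bound_series_cvg_prod (R : realType) (X : completeNormedModType R)
    (q : R) (u : nat -> X * X) : 0 <= q < 1 ->
  (exists M, forall n, `|u n| <= M * q ^+ n) ->
  exists l : X * X, series u n @[n --> \oo] --> l.
Proof.
move=> q01 [M uM].
have c1 : cvgn (series (fun n => (u n).1)).
  apply: (geometric_bound_series_cvg _ _ _ M q) => // n.
  by apply: le_trans (uM n); rewrite prod_normE le_max lexx.
have c2 : cvgn (series (fun n => (u n).2)).
  apply: (geometric_bound_series_cvg _ _ _ M q) => // n.
  by apply: le_trans (uM n); rewrite prod_normE le_max lexx orbT.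
exists (limn (series (fun n => (u n).1)), limn (series (fun n => (u n).2))).
have -> : (fun n => series u n) =
    fun n => (series (fun n => (u n).1) n, series (fun n => (u n).2) n).
  apply/funext; elim=> [|n IH]; first by rewrite !seriesEnat /= !big_geq.
  by rewrite !seriesSr IH; case: (u n).
exact: cvg_pair.
Qed.

(** * Spectrum of the complexified operator *)

Section ComplexifiedResolvent.
Variables (R : realType) (X : completeNormedModType R) (T : {linear X -> X}).

Ltac module := module_with R X.

Let TP (a b : R) x y : T (a *: x + b *: y) = a *: T x + b *: T y.
Proof. by rewrite linearD !(linearZZ T). Qed.

(** Multiplication by the complex number [al + i be] on the complexification. *)
Definition complex_scale (al be : R) (p : X * X) : X * X :=
  (al *: p.1 - be *: p.2, be *: p.1 + al *: p.2).

(** With [mu = a + i b] and [V = mu^-1 T], one has [T - mu = - mu (1 - V)], and the powers of [V]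
    decay at the rate [l / |mu| < 1]. *)
Lemma notin_spectrum (K l a b : R) : 0 <= K -> 0 < l -> l ^+ 2 < a ^+ 2 + b ^+ 2 ->
  (forall n x, `|iter n T x| <= K * l ^+ n * `|x|) -> ~ spectrum T (a, b).
Proof.
move=> K0 l0 lab TK; rewrite /spectrum /=; apply.
set N := a ^+ 2 + b ^+ 2 in lab.
have N0 : 0 < N by apply: le_lt_trans lab; exact: sqr_ge0.
have Nn0 : a ^+ 2 + b ^+ 2 != 0 by rewrite gt_eqF.
pose al := a / N; pose be := - b / N.
pose VT (p : X * X) := complex_scale al be (T p.1, T p.2).
have linV : linear VT.
  move=> c p p'; rewrite /VT /complex_scale /=.
  have lin1 x y : T (c *: x + y) = c *: T x + T y by exact: linearP.
  by apply: injective_projections; rewrite /= !lin1; module.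
pose V : {linear (X * X)%type -> (X * X)%type} :=
  HB.pack VT (GRing.isLinear.Build _ _ _ _ _ linV).
have albe : al ^+ 2 + be ^+ 2 = N^-1.
  by rewrite /al /be /N; field.
(* [c + i d] is [mu^-n]; only its modulus matters for the estimate. *)
have iterV n : exists c d : R, c ^+ 2 + d ^+ 2 = N^-1 ^+ n /\
    forall p, iter n V p = complex_scale c d (iter n T p.1, iter n T p.2).
  elim: n => [|n [c [d [cd IH]]]].
    exists 1, 0; split; first by rewrite expr0; ring.
    by move=> [x y]; rewrite /complex_scale /=; apply: injective_projections => /=; module.
  exists (al * c - be * d), (al * d + be * c); split.
    by rewrite [N^-1 ^+ _]exprS -cd -albe; ring.
  move=> [x y] /=; rewrite IH /= /VT /complex_scale /=.
  have -> : c *: iter n T x - d *: iter n T y = c *: iter n T x + (- d) *: iter n T y by module.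
  by rewrite !TP; apply: injective_projections => /=; module.
pose r := Num.sqrt N^-1.
have r0 : 0 < r by rewrite sqrtr_gt0 invr_gt0.
have r2 : r ^+ 2 = N^-1 by rewrite sqr_sqrtr// invr_ge0 ltW.
have q01 : 0 <= r * l < 1.
  apply/andP; split; first by apply: mulr_ge0; exact: ltW.
  rewrite -(@expr_lt1 _ 2)//; last by apply: mulr_ge0; exact: ltW.
  by rewrite exprMn r2 mulrC ltr_pdivrMr// mul1r.
(* The factor 2 arises because each component is a sum of two terms, under the maximum norm. *)
have V_le n (p : X * X) : `|iter n V p| <= 2 * K * (r * l) ^+ n * `|p|.
  have [c [d [cd ->]]] := iterV n.
  have rn0 : 0 <= r ^+ n by rewrite exprn_ge0// ltW.
  have cdr : c ^+ 2 + d ^+ 2 = (r ^+ n) ^+ 2 by rewrite cd -r2 exprAC.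
  have cr : `|c| <= r ^+ n.
    by rewrite -(@ler_pXn2r _ 2)// ?nnegrE// real_normK ?num_real// -cdr lerDl sqr_ge0.
  have dr : `|d| <= r ^+ n.
    by rewrite -(@ler_pXn2r _ 2)// ?nnegrE// real_normK ?num_real// -cdr lerDr sqr_ge0.
  have [p1 p2] : `|p.1| <= `|p| /\ `|p.2| <= `|p|.
    by rewrite prod_normE !le_max !lexx orbT.
  have est (e : R) x : `|e| <= r ^+ n -> `|x| <= `|p| ->
      `|e *: iter n T x| <= r ^+ n * (K * l ^+ n * `|p|).
    move=> er xp; rewrite normrZ; apply: ler_pM => //.
    apply: le_trans (TK n x) _; apply: ler_wpM2l => //.
    by rewrite mulr_ge0// exprn_ge0// ltW.
  have -> : 2 * K * (r * l) ^+ n * `|p| =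
      r ^+ n * (K * l ^+ n * `|p|) + r ^+ n * (K * l ^+ n * `|p|).
    by rewrite exprMn; ring.
  rewrite prod_normE ge_max /complex_scale /=; apply/andP; split.
    by apply: le_trans (ler_normB _ _) _; apply: lerD; exact: est.
  by apply: le_trans (ler_normD _ _) _; apply: lerD; exact: est.
have [S [cS SK KS]] := neumann_inverse R _ V _ _ q01
  (fun u => geometric_bound_series_cvg_prod R X _ u q01) V_le.
(* [A] multiplies by [- mu^-1], so it turns [T - mu] into [1 - V]. *)
pose A p := complex_scale (- al) (- be) p.
have AE p : A (complexified_shift T a b p) = p - V p.
  case: p => x y; rewrite /A /complexified_shift /complex_scale /= /VT /complex_scale /=.
  by apply: injective_projections; rewrite /= /al /be /N; module.
have AK p : complex_scale (- a) (- b) (A p) = p.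
  case: p => x y; rewrite /A /complex_scale /=.
  by apply: injective_projections; rewrite /= /al /be /N; module.
have linA : linear A.
  move=> c p p'; rewrite /A /complex_scale /=.
  by apply: injective_projections => /=; module.
pose Al : {linear (X * X)%type -> (X * X)%type} :=
  HB.pack A (GRing.isLinear.Build _ _ _ _ _ linA).
have cA : continuous A.
  have : continuous Al; last by [].
  apply: (@continuous_of_bound _ _ _ _ (`|al| + `|be|)) => p /=.
  have [p1 p2] : `|p.1| <= `|p| /\ `|p.2| <= `|p|.
    by rewrite prod_normE !le_max !lexx orbT.
  have est (e : R) (x : X) : `|x| <= `|p| -> `|- e *: x| <= `|e| * `|p|.
    by move=> xp; rewrite normrZ normrN; apply: ler_wpM2l.
  rewrite [leLHS]prod_normE ge_max mulrDl /A /complex_scale /=; apply/andP; split.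
    by apply: le_trans (ler_normB _ _) _; apply: lerD; exact: est.
  by apply: le_trans (ler_normD _ _) _; rewrite addrC; apply: lerD; exact: est.
exists (S \o A); split.
- by move=> p; apply: continuous_comp; [exact: cA|exact: cS].
- by move=> p; rewrite /= AE SK.
- by move=> p; rewrite -[LHS]AK AE /= KS AK.
Qed.

Lemma spectral_radius_le (K l : R) : 0 <= K -> 0 < l ->
  (forall n x, `|iter n T x| <= K * l ^+ n * `|x|) ->
  (spectral_radius T <= l%:E)%E.
Proof.
move=> K0 l0 TK; apply/ereal_supP => _ [[a b] Tab <-] /=.
rewrite lee_fin leNgt; apply/negP => lab; move: Tab.
apply: (notin_spectrum K l) => //.
rewrite -[ltRHS]sqr_sqrtr ?addr_ge0 ?sqr_ge0//.
by rewrite ltr_pXn2r// nnegrE ?sqrtr_ge0// ltW.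
Qed.

(** The continuous inverse of [T - l] on the complexification is linear, hence bounded; the estimate
    is read off at the real vectors [(x, 0)]. *)
Lemma resolvent_bound (l : R) : (spectral_radius T < 1)%E -> 1 <= l ->
  exists2 s : R, 0 < s & forall x, `|x| <= s * `|l *: x - T x|.
Proof.
move=> rT l1.
have : ~ spectrum T (l, 0).
  move=> lT; move: rT; apply/negP; rewrite -leNgt.
  apply: le_ereal_sup_tmp; exists (Num.sqrt (l ^+ 2 + 0 ^+ 2))%:E; first by exists (l, 0).
  rewrite expr0n addr0 sqrtr_sqr lee_fin ger0_norm//; lra.
move=> /contrapT[S [cS SK KS]].
pose U := complexified_shift T l 0.
have linU : linear U.
  move=> c p p'; rewrite /U /complexified_shift /=.
  have lin1 x y : T (c *: x + y) = c *: T x + T y by exact: linearP.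
  by apply: injective_projections; rewrite /= !lin1; module.
pose Ul : {linear (X * X)%type -> (X * X)%type} :=
  HB.pack U (GRing.isLinear.Build _ _ _ _ _ linU).
have linS : linear S by apply: (@can2_linear _ _ _ Ul).
pose Sl : {linear (X * X)%type -> (X * X)%type} :=
  HB.pack S (GRing.isLinear.Build _ _ _ _ _ linS).
have cSl : continuous Sl by [].
have /linear_bounded_continuous/linear_boundedP/pinfty_ex_gt0[s s0 hs] := cSl.
exists s => // x.
have := hs (U (x, 0)).
have -> : Sl (U (x, 0)) = (x, 0) by exact: SK.
have -> : U (x, 0) = (- (l *: x - T x), 0).
  rewrite /U /complexified_shift /= (linear0 T).
  by apply: injective_projections => /=; module.
by rewrite !prod_normE /= normrN normr0 !max_l.
Qed.

End ComplexifiedResolvent.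

(** * The cycle of implications *)

Theorem theorem3p11 (R : realType) (X : completeNormedModType R) (C : set X)
    (T : {linear X -> X}) :
  is_cone C -> normal_cone C -> C° !=set0 ->
  continuous T -> positive_op C T ->
  [<->
   (* (i) *)   (spectral_radius T < 1)%E;
   (* (ii) *)  (forall x' : X -> R, dual_elt x' -> dual_pos C x' ->
                  ~ (forall x, x' x = 0) ->
                  ~ dual_pos C (fun x => dual_op T x' x - x' x));
   (* (iii) *) (forall z, C° z -> exists2 eta : R, 0 < eta &
                  forall x, C x -> x <> 0 ->
                    ~ cone_le C (x - (eta * `|x|) *: z) (T x));
   (* (iv) *)  (exists2 z, C° z & exists2 eta : R, 0 < eta &
                  forall x, C x -> x <> 0 ->
                    ~ cone_le C (x - (eta * `|x|) *: z) (T x));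
   (* (v) *)   (exists2 z, C° z & cone_ll C (T z) z);
   (* (vi) *)  (exists2 z, C° z & exists2 lambda : R, 0 < lambda < 1 &
                  cone_le C (T z) (lambda *: z));
   (* (vii) *) (forall x : X, (fun k : nat => iter k T x) @ \oo --> (0 : X));
   (* (viii) *)(forall x, C x -> inf [set `|iter k T x| | k in [set: nat]] = 0)].
Proof.
move=> hC nC [u Cu] cT pT.
(* [E] is (vi); the implications from (i), (ii) and (viii) all pass through it. *)
pose E := exists2 z, C° z & exists2 l : R, 0 < l < 1 & C (l *: z - T z).
have sub1E : sub_eigenvalue R X C T 1 -> E.
  move=> [z Cz]; rewrite scale1r => Tz; exists z => //.
  exact: scaled_le_of_ll.
have bnd : E -> exists2 l : R, 0 < l < 1 & exists2 K : R, 0 <= K &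
    forall n x, `|iter n T x| <= K * l ^+ n * `|x|.
  move=> [z Cz [l /andP[l0 l1] lz]]; exists l; first by rewrite l0.
  exact: (norm_iter_le R X C T hC nC pT z l Cz (ltW l0) lz).
tfae.
- move=> rT f df pf f0 fT; apply: f0.
  have [z Cz [l /andP[l0 l1] lz]] : E.
    apply/sub1E/(sub_eigenvalue_of_resolvent R X C T hC nC pT u Cu) => l.
    exact: resolvent_bound.
  exact: (dual_small_gain R X C T hC z l Cz lz).
- move=> dual z0 Cz0.
  have [z Cz [l /andP[l0 l1] lz]] : E.
    exact/sub1E/(sub_eigenvalue_of_dual_small_gain R X C T hC u Cu).
  exact: (uniform_small_gain R X C T hC nC pT z l Cz (ltW l0) lz).
- by move=> /(_ u Cu); exists u.
- move=> [z Cz [eta eta0 h]].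
  have [y Cy] := sub_eigenvalue_of_uniform_small_gain R X C T hC pT z eta Cz eta0 h.
  by rewrite scale1r; exists y.
- by move=> [z Cz Tz]; apply: sub1E; exists z; rewrite ?scale1r.
- move=> /bnd[l /andP[l0 l1] [K K0 TK]] x.
  by apply: (geometric_bound_cvg0 _ _ _ (K * `|x|) l);
    [rewrite ltW|move=> n; rewrite mulrAC].
- move=> h x Cx; set A := [set _ | _ in _].
  have lbA : lbound A 0 by move=> _ [k _ <-].
  have A0 : A !=set0 by exists `|x|; exists 0%N.
  apply/eqP; rewrite eq_le lb_le_inf// andbT; apply/ler_addgt0Pr => e e0.
  have /cvgr0Pnorm_lt/(_ _ e0)[n _ hn] := h x.
  rewrite add0r; apply: le_trans (ltW (hn n (leqnn n))).
  by apply: ge_inf; [exists 0|exists n].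
- move=> h.
  have [M M0 MC] : exists2 M : R, 0 < M & forall x, C ((M * `|x|) *: u - x).
    exact/cone_interiorP.
  have Cu' := interior_cone _ _ _ _ Cu.
  (* An iterate of [u] with norm below [(2 * M)^-1] is at most [u / 2] in the order. *)
  have e0 : 0 < (2 * M)^-1 by rewrite invr_gt0 mulr_gt0.
  have infA : has_inf [set `|iter k T u| | k in [set: nat]].
    by split; [exists `|u|; exists 0%N|exists 0 => _ [k _ <-]].
  have [_ [k _ <-]] := inf_adherent e0 infA; rewrite (h u Cu') add0r => ku.
  have [l /andP[l0 l1] [K K0 TK]] : exists2 l : R, 0 < l < 1 & exists2 K : R, 0 <= K &
      forall n x, `|iter n T x| <= K * l ^+ n * `|x|.
    apply/bnd/(sub_eigenvector_of_iter R X C T hC pT u k Cu).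
    have -> : 2^-1 *: u - iter k T u = (2^-1 - M * `|iter k T u|) *: u +
       ((M * `|iter k T u|) *: u - iter k T u).
      by rewrite scalerBl addrA subrK.
    apply: coneD => //; apply: coneZ => //; rewrite subr_ge0 -ler_pdivlMl//.
    by rewrite -invfM mulrC ltW.
  apply: le_lt_trans (spectral_radius_le R X T K l K0 l0 TK) _.
  by rewrite lte_fin.
Qed.
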